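(* The countable power of the Sorgenfrey line (the product of countably infinitely many copies of the Sorgenfrey line, with the product topology) is a D-space.
   Context: The Sorgenfrey line is the real line with the topology generated by the base $\{[a,b):a<b\}$. A topological space $X$ is a D-space iff for every function $\varphi$ assigning to each $p\in X$ an open neighbourhood $\varphi(p)$ of $p$ there is a closed discrete subset $D$ of $X$ such that $\bigcup_{p\in D}\varphi(p)=X$. (A set $D$ is discrete iff each $q\in D$ has an open neighbourhood $O(q)$ with $O(q)\cap D=\{q\}$.) *)

(* Defs.v *)
From HB Require Import structures.
From mathcomp Require Import all_boot all_order all_algebra.
From mathcomp Require Import all_classical all_reals all_analysis.
Import Order.TTheory GRing.Theory Num.Theory numFieldNormedType.Exports.

Set Implicit Arguments.
Unset Strict Implicit.
Unset Printing Implicit Defensive.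

Local Open Scope classical_set_scope.
Local Open Scope ring_scope.

(* An alias of R, so that the half-open interval topology below does not
   clash with the Euclidean one carried by R itself. *)
Definition sorgenfrey (R : realType) : Type := R.

Section Sorgenfrey.
Variable R : realType.

HB.instance Definition _ := Choice.copy (sorgenfrey R) R.

Definition sorgenfrey_index : set (R * R) := [set ab | ab.1 < ab.2].

Definition sorgenfrey_base (ab : R * R) : set (sorgenfrey R) :=
  [set x : R | ab.1 <= x < ab.2].

Lemma sorgenfrey_base_cover :
  \bigcup_(ab in sorgenfrey_index) sorgenfrey_base ab = setT.
Proof.
apply/seteqP; split=> // x _.
exists ((x : R), (x : R) + 1); rewrite /sorgenfrey_index /sorgenfrey_base /=.
  by rewrite ltrDl.
by rewrite lexx ltrDl ltr01.
Qed.

Lemma sorgenfrey_base_join (ab cd : R * R) (t : sorgenfrey R) :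
  sorgenfrey_index ab -> sorgenfrey_index cd ->
  sorgenfrey_base ab t -> sorgenfrey_base cd t ->
  exists ef, [/\ sorgenfrey_index ef, sorgenfrey_base ef t &
    sorgenfrey_base ef `<=` sorgenfrey_base ab `&` sorgenfrey_base cd].
Proof.
case: ab cd => [a b] [c d] _ _; rewrite /sorgenfrey_index /sorgenfrey_base /=.
move=> /andP[at_ tb] /andP[ct td].
exists ((t : R), Num.min b d); split => /=.
- by rewrite lt_min tb td.
- by rewrite lexx lt_min tb td.
- move=> x /=; rewrite lt_min => /and3P[tx xb xd].
  by split; rewrite ?xb ?xd ?(le_trans at_ tx) ?(le_trans ct tx).
Qed.

HB.instance Definition _ := @isBaseTopological.Build (sorgenfrey R)
  (R * R)%type sorgenfrey_index sorgenfrey_base sorgenfrey_base_cover sorgenfrey_base_join.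

End Sorgenfrey.

Definition discrete_subset (X : topologicalType) (D : set X) : Prop :=
  forall q, D q -> exists2 O : set X, open_nbhs q O & O `&` D = [set q].

Definition D_space (X : topologicalType) : Prop :=
  forall phi : X -> set X, (forall p, open_nbhs p (phi p)) ->
  exists D : set X,
    [/\ closed D, discrete_subset D & \bigcup_(p in D) phi p = setT].

(* Main.v *)
Require Import Defs.
From mathcomp Require Import all_boot all_order all_algebra.
From mathcomp Require Import all_classical all_reals all_analysis.
From mathcomp Require Import lra.
From mathcomp Require wochoice.

(** Fix a neighbourhood assignment N on the countable power X of the Sorgenfrey
  line, and call a closed set F coverable if some closed discrete D included in
  F has a star (the union of the N p for p in D) that includes F.

  Slices.  Suppose X is not coverable.  If every non-coverable closed set
  contains, for each m, a non-coverable closed set whose points share their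
  first m coordinates, then there is a decreasing sequence of such sets with
  m = 1, 2, 3 and so on.  The coordinates fixed along the way define a point y
  that lies in all these sets, and N y, which depends on finitely many
  coordinates around y, includes one of them: that set is covered by y alone, a
  contradiction.  So it is enough to cover F when all closed subsets of its
  slices, where finitely many coordinates are fixed, are coverable
  (coverable_of_slices, coverable_setT).

  Pieces.  X is a countable union of pieces A, each with an n >= m such that
  N p contains every q of A with p <= q on the first n coordinates.  Covering
  the pieces one after the other is harmless, because every point is swallowed
  at a finite stage by an open set that the later stages avoid
  (coverable_countable).  So one piece A has to be covered from below, in the
  coordinatewise order of R^n.

  Critical points.  If A were the upward closure of its minimal elements, those
  would do, since an antichain of R^n is closed discrete in the Sorgenfrey
  topology (closed_discrete_antichain).  In general A has only almost minimal
  elements, below which A descends by at most d, for each d > 0.  Let y in F be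
  critical if it is a limit of elements of A that are d-almost minimal with d
  tending to 0.  The proof rests on two facts.
  - Critical slices can be removed.  Choose a critical y, cover its whole slice
    (the points with the same first n coordinates), take what is left of F, and
    repeat transfinitely.  Near a given point only finitely many stages matter:
    a later critical point of the same type that is closer to the limit would
    push A strictly below elements that an earlier stage saw as almost minimal
    (critical_no_descent, exhaust_critical).
  - Without critical points, A can be covered.  There are countably many tasks
    (K, r), with K a set of coordinates and r a rational bound on each of the
    others.  The j-th task looks at the elements of A that are 1/(j+1)-almost
    minimal and respect the bounds, and selects those that are minimal on K,
    one for each value on K; this is an antichain.  A limit of selections from
    infinitely many tasks would be critical, so the union of the selections is
    closed discrete.  Every b in A lies above a selected point: take a below b
    in A with as few coordinates in common with b as possible, let K be the set
    of these coordinates, and separate a from b by rationals on the others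
    (cover_noncritical). *)

Set Implicit Arguments.
Unset Strict Implicit.
Unset Printing Implicit Defensive.

Import Order.TTheory GRing.Theory Num.Theory.
Local Open Scope classical_set_scope.
Local Open Scope ring_scope.

(** * Closed discrete sets *)

Section ClosedDiscrete.
Variable X : topologicalType.
Implicit Types (x : X) (D E G : set X).

Definition closed_discrete D := forall x, \forall e \near x, D e -> e = x.

Lemma closed_discrete_closed D : closed_discrete D -> closed D.
Proof.
by move=> cdD x /(_ _ (cdD x))[e [De]] /(_ De) <-.
Qed.

Lemma closed_discrete_discrete D : closed_discrete D -> discrete_subset D.
Proof.
move=> cdD q Dq; have : nbhs q [set e | D e -> e = q] := cdD q.
rewrite nbhsE => -[B oB sB].
exists B => //; apply/seteqP; split=> [e [Be De]|e ->]; first exact: sB.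
by split=> //; case: oB.
Qed.

Lemma closed_discrete0 : closed_discrete set0.
Proof. by move=> x; apply: nearW. Qed.

Lemma closed_discreteU D E :
  closed_discrete D -> closed_discrete E -> closed_discrete (D `|` E).
Proof.
move=> cD cE x; near=> e => -[]; near: e.
  exact: cD.
exact: cE.
Unshelve. all: by end_near. Qed.

Lemma near_bounded_union (D : nat -> set X) x (k : nat) :
  (forall j, \forall e \near x, D j e -> e = x) ->
  \forall e \near x, forall j, (j < k)%N -> D j e -> e = x.
Proof.
move=> cD; elim: k => [|k IH]; first exact: nearW.
near=> e => j; rewrite ltnS leq_eqVlt => /orP[/eqP->|jk].
  by near: e; exact: cD.
by move: j jk; near: e.
Unshelve. all: by end_near. Qed.

Lemma near_notin_closed G x : closed G -> ~ G x -> \forall e \near x, ~ G e.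
Proof.
move=> cG nGx; apply: (@open_nbhs_nbhs _ _ (~` G)); split=> //.
exact: closed_openC.
Qed.

End ClosedDiscrete.

(** * Neighbourhood assignments and well-founded stages *)

Section Assignments.
Variables (X : topologicalType) (N : X -> set X).
Hypothesis NP : forall p, open_nbhs p (N p).
Implicit Types (F G D : set X).

Definition star D := \bigcup_(p in D) N p.

Lemma open_star D : open (star D).
Proof. by apply: bigcup_open => p _; case: (NP p). Qed.

Lemma starU D E : star (D `|` E) = star D `|` star E.
Proof. exact: bigcup_setU. Qed.

Definition coverable F :=
  exists D, [/\ D `<=` F, closed_discrete D & F `<=` star D].

Section Stages.
Variables (W : Type) (lt : W -> W -> Prop).

Definition residue F (D : W -> set X) w :=
  F `\` \bigcup_(v in [set v | lt v w]) star (D v).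

Lemma closed_residue F (D : W -> set X) w : closed F -> closed (residue F D w).
Proof.
move=> cF; rewrite /residue setDE; apply: closedI => //.
by apply: open_closedC; apply: bigcup_open => v _; exact: open_star.
Qed.

Lemma residue_sub F (D : W -> set X) w : residue F D w `<=` F.
Proof. by move=> x []. Qed.

(** The residue at a stage is closed whatever was chosen before, so the choices
  can be made by plain recursion, and their properties proved afterwards. *)
Lemma wf_stages (pick : W -> set X -> set X) F : well_founded lt ->
  exists D : W -> set X, forall w, D w = pick w (residue F D w).
Proof.
move=> wf.
pose step w (rec : forall v, lt v w -> set X) :=
  pick w (F `\` [set x | exists v (h : lt v w), star (rec v h) x]).
exists (Fix wf (fun=> set X) step) => w; rewrite Fix_eq; last first.
  move=> v f g fg; congr step; apply: functional_extensionality_dep => u.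
  exact: functional_extensionality_dep.
congr pick; congr setD; apply/seteqP; split=> x.
  by move=> [v [h]]; exists v.
by move=> [v h]; exists v, h.
Qed.

End Stages.

Lemma residueW (W : Type) (lt : W -> W -> Prop) F (D : W -> set X) v w :
  (forall u, lt u v -> lt u w) -> residue lt F D w `<=` residue lt F D v.
Proof.
by move=> vw x [Fx nx]; split=> // -[u uv ux]; apply: nx; exists u => //; exact: vw.
Qed.

(** Stage i covers what is left of A i.  A point of F is then swallowed at some
  finite stage by an open star that all later stages avoid, so only finitely
  many stages matter near it. *)
Lemma coverable_countable F (A : nat -> set X) : closed F ->
  (forall x, F x -> exists i, A i x) ->
  (forall i G, closed G -> G `<=` F -> exists D,
    [/\ D `<=` G, closed_discrete D & A i `&` G `<=` star D]) ->
  coverable F.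
Proof.
move=> cF AF H.
pose ok i G D := [/\ D `<=` G, closed_discrete D & A i `&` G `<=` star D].
have [D DE] := wf_stages (fun i G => get (ok i G)) F Wf_nat.lt_wf.
pose G := residue Peano.lt F D.
have DP i : ok i (G i) (D i).
  rewrite DE; apply: (@getPex _ (ok i (G i))).
  by apply: H; [exact: closed_residue | exact: residue_sub].
have covered x : F x -> exists j, star (D j) x.
  move=> Fx; have [i Aix] := AF x Fx.
  have [[j _ jx]|nx] := pselect ((\bigcup_(j in [set j | Peano.lt j i]) star (D j)) x).
    by exists j.
  by exists i; have [_ _] := DP i; apply; split.
exists (\bigcup_i D i); split.
- by move=> x [i _]; have [DG _ _] := DP i; move=> /DG[].
- move=> x; have [Fx|nFx] := pselect (F x); last first.
    near=> e => -[i _]; have [DG _ _] := DP i; move=> /DG[Fe _].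
    by suff: ~ F e by []; near: e; exact: near_notin_closed.
  have [j xj] := covered x Fx.
  near=> e => -[i _ Die]; have [ij|ji] := leqP i j.
    have : (i < j.+1)%N by [].
    move: i {ij} Die; near: e.
    have : \forall e \near x, forall i, (i < j.+1)%N -> D i e -> e = x.
      by apply: near_bounded_union => i; have [_ + _] := DP i; exact.
    by apply: filterS => e He i Die ij; exact: He ij Die.
  have [DG _ _] := DP i; have [_ []] := DG _ Die; exists j => //=.
    exact/ssrnat.ltP.
  by near: e; apply: open_nbhs_nbhs; split; [exact: open_star|].
- by move=> x /covered[j [p Djp Npx]]; exists p => //; exists j.
Unshelve. all: by end_near. Qed.

End Assignments.

(** * Well-orders without injection into a given type *)

Lemma exists_well_founded (W : Type) : exists lt : W -> W -> Prop,
  [/\ well_founded lt, (forall u v w, lt u v -> lt v w -> lt u w) &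
      forall u v, u <> v -> lt u v \/ lt v u].
Proof.
have [le wo] := wochoice.well_ordering_principle {classic W}.
have min1 (P : set W) : P !=set0 -> exists2 z, P z & forall x, P x -> le z x.
  move=> [w Pw]; have [|z [[zP zmin] _]] := wo [pred x | `[< P x >]].
    by exists w; apply/asboolP.
  exists z; first exact/asboolP.
  by move=> x Px; apply: zmin; apply/asboolP.
have tot (u v : {classic W}) : le u v \/ le v u.
  have [|z [->|->] zmin] := min1 [set u; v]; first by exists u; left.
    by left; apply: zmin; right.
  by right; apply: zmin; left.
have refl (u : {classic W}) : le u u by case: (tot u u).
have anti (u v : {classic W}) : le u v -> le v u -> u = v.
  move=> uv vu; have [|z [_ zuniq]] := wo [pred x | `[< [set u; v] x >]].
    by exists u; apply/asboolP; left.
  rewrite -(zuniq u) ?(zuniq v) //; split.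
  - by apply/asboolP; right.
  - by move=> w /asboolP[->|->].
  - by apply/asboolP; left.
  - by move=> w /asboolP[->|->].
have trans (u v w : {classic W}) : le u v -> le v w -> le u w.
  move=> uv vw; have [|z Pz zmin] := min1 [set x | x = u \/ x = v \/ x = w].
    by exists u; left.
  have zu : le z u by apply: zmin; left.
  have zv : le z v by apply: zmin; right; left.
  have zw : le z w by apply: zmin; right; right.
  case: Pz => [zE|[zE|zE]]; subst z => //.
    by rewrite (anti _ _ uv zu).
  by rewrite -(anti _ _ vw zv).
exists (fun u v : {classic W} => le u v /\ u <> v); split.
- move=> w; apply: contrapT => nacc.
  have [|z nz zmin] := min1 [set x | ~ Acc (fun u v : {classic W} => le u v /\ u <> v) x].
    by exists w.
  apply: nz; constructor => y [yz nyz]; apply: contrapT => ny.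
  by apply: nyz; apply: anti => //; exact: zmin.
- move=> u v w [uv nuv] [vw nvw]; split; first exact: trans vw.
  by move=> uw; subst w; apply: nuv; exact: anti.
- by move=> u v uv; case: (tot u v) => ?; [left|right]; split=> // vu; exact: uv.
Qed.

(** Cantor's diagonal argument: a process indexed by a well-order of the subsets
  of T cannot pick a new element of T at every stage. *)
Lemma no_injection_from_powerset (T : Type) (f : set T -> T) : ~ injective f.
Proof.
move=> finj; pose S := [set t | exists2 A, f A = t & ~ A t].
have nS : ~ S (f S) by move=> [A /finj->] nS; apply: (nS); exists S.
by apply: (nS); exists S.
Qed.

(** * Two selection lemmas *)

Lemma exists_transversal (T : choiceType) (V : Type) (M : set T) (f : T -> V) :
  exists D, [/\ D `<=` M, forall b, M b -> exists2 d, D d & f d = f b &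
    forall d d', D d -> D d' -> f d = f d' -> d = d'].
Proof.
have [M0|/set0P[x0 _]] := eqVneq M set0.
  by exists set0; split=> // b; rewrite M0.
pose g v := xget x0 [set a | M a /\ f a = v].
have gP b : M b -> M (g (f b)) /\ f (g (f b)) = f b.
  by move=> Mb; have := @xgetPex _ x0 [set a | M a /\ f a = f b]; apply; exists b.
exists [set g (f b) | b in M]; split=> [_ [b Mb <-]|b Mb|_ _ [b Mb <-] [b' Mb' <-]].
- by have [] := gP _ Mb.
- by exists (g (f b)); [exists b | have [] := gP _ Mb].
- by have [_ ->] := gP _ Mb; have [_ ->] := gP _ Mb'; move=> ->.
Qed.

Lemma finite_positive_lower_bound (R : realFieldType) (I : finType)
    (P : pred I) (f : I -> R) : (forall i, P i -> 0 < f i) ->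
  exists2 d, 0 < d & forall i, P i -> d <= f i.
Proof.
move=> fP; exists (\big[Num.min/1]_(i | P i) f i).
  by apply: (big_ind (fun z => 0 < z)) => // x y x0 y0; rewrite lt_min x0.
by move=> i Pi; rewrite (bigD1 i) //= ge_min lexx.
Qed.

(** * Covering from below in a finite Sorgenfrey power *)

(** The first hypothesis says that c is continuous from X to the Sorgenfrey
  power R^I, and the second one that X is T1. *)
Section Cones.
Variables (R : realType) (X : topologicalType) (I : finType) (c : X -> I -> R).
Hypothesis near_cone : forall x e, 0 < e ->
  \forall y \near x, forall i, c x i <= c y i < c x i + e.
Hypothesis near_ne : forall x y : X, \forall e \near x, e = y -> e = x.
Implicit Types (A D F G : set X) (K : {set I}).

Definition below p q := forall i, c p i <= c q i.

Definition agree p q : {set I} := finset (fun i => c p i == c q i).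

Lemma below_trans q p r : below p q -> below q r -> below p r.
Proof. by move=> pq qr i; exact: le_trans (qr i). Qed.

Lemma agreeP p q i : (i \in agree p q) = (c p i == c q i).
Proof. by rewrite inE. Qed.

(** The elements of D near x lie above x.  Classify them by the set K1 of the
  coordinates they share with x: once one element d of a class is known, any
  element of the class that is close enough to x is below d, hence equal to d. *)
Lemma closed_discrete_antichain K D :
  (forall d d', D d -> D d' -> (forall i, i \in K -> c d i <= c d' i) -> d = d') ->
  closed_discrete D.
Proof.
move=> anti x.
have type_near K1 : \forall e \near x, D e -> below x e -> agree e x = K1 -> e = x.
  have [[d [Dd xd dK1]]|none] :=
    pselect (exists d, [/\ D d, below x d & agree d x = K1]);
    last by apply: nearW => e De xe eK1; exfalso; apply: none; exists e.
  have [|m m0 mP] := @finite_positive_lower_bound R I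
      (fun i => i \notin K1) (fun i => c d i - c x i).
    by move=> i; rewrite -dK1 agreeP subr_gt0 lt_neqAle eq_sym => ->; exact: xd.
  near=> e => De xe eK1; have ed : e = d.
    apply: anti => // i _; have [iK1|/mP] := boolP (i \in K1).
      have := iK1; rewrite -eK1 agreeP => /eqP ->.
      by move: iK1; rewrite -dK1 agreeP => /eqP ->.
    have /(_ i) : forall i, c x i <= c e i < c x i + m by near: e; exact: near_cone.
    by move=> /andP[_]; lra.
  by move: ed; near: e; exact: near_ne.
have all_types : \forall e \near x, forall K1,
    D e -> below x e -> agree e x = K1 -> e = x.
  exact: filter_forall.
near=> e => De.
have He : forall K1, D e -> below x e -> agree e x = K1 -> e = x by near: e.
apply: (He (agree e x)) => // i.
have /(_ i) : forall i, c x i <= c e i < c x i + 1 by near: e; exact: near_cone.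
by case/andP.
Unshelve. all: by end_near. Qed.

Definition almost_minimal A d b :=
  A b /\ forall a, A a -> below a b -> forall i, c b i - c a i <= d.

Lemma almost_minimalW A d d' b :
  d <= d' -> almost_minimal A d b -> almost_minimal A d' b.
Proof.
by move=> dd' [Ab bP]; split=> // a Aa ab i; exact: le_trans (bP a Aa ab i) dd'.
Qed.

(** An element a of A below b that is not d-almost minimal lies above an element
  of A whose sum of coordinates is smaller by d; such steps end, because A is
  bounded below. *)
Lemma almost_minimal_below A M d b : (forall a, A a -> forall i, M <= c a i) ->
  0 < d -> A b -> exists2 a, almost_minimal A d a & below a b.
Proof.
move=> AM d0 Ab; apply: contrapT => none.
pose s a := \sum_i c a i.
have step a : A a -> below a b -> exists a', [/\ A a', below a' b & s a' <= s a - d].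
  move=> Aa ab; apply: contrapT => na; apply: none; exists a => //.
  split=> // a' Aa' a'a i.
  rewrite leNgt; apply/negP => di; apply: na; exists a'; split=> //.
    exact: below_trans ab.
  rewrite /s (bigD1 i) //= [X in _ <= X - d](bigD1 i) //=.
  have : \sum_(j | j != i) c a' j <= \sum_(j | j != i) c a j.
    by apply: ler_sum => j _; exact: a'a.
  by move: di; lra.
have desc k : exists a, [/\ A a, below a b & s a <= s b - d *+ k].
  elim: k => [|k [a [Aa ab sa]]]; first by exists b; split; rewrite ?mulr0n ?subr0.
  have [a' [Aa' a'b sa']] := step a Aa ab; exists a'; split=> //.
  by rewrite mulrS; lra.
have [k kP] : exists k, s b - \sum_(i : I) M < d *+ k.
  exists (Num.bound `|(s b - \sum_(i : I) M) / d|).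
  rewrite -mulr_natl -ltr_pdivrMr//; apply: le_lt_trans (ler_norm _) _.
  by apply: archi_boundP; exact: normr_ge0.
have [a [Aa ab sa]] := desc k.
have : \sum_(i : I) M <= s a by apply: ler_sum => i _; exact: AM.
by move: kP sa; lra.
Qed.

(** The approximating elements e all share with y the same set K of coordinates.
  This makes approximants of two critical points comparable in
  [critical_no_descent]; as there are finitely many K, it costs nothing. *)
Definition critical K A y := forall d, 0 < d -> exists e,
  [/\ almost_minimal A d e, below y e, forall i, c e i < c y i + d & agree e y = K].

(** Suppose that y' is critical of type K for a smaller set A', shares with x the
  same coordinates as y does, and is much closer to x than y.  An approximant
  e' of y' is then below an approximant e of y: on the coordinates where x and
  y agree this uses the common type K, and on the others e' is close to x.  But
  e' is far below e, which was almost minimal. *)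
Lemma critical_no_descent K A x y :
  critical K A y -> below x y -> ~ below y x ->
  exists2 d, 0 < d & forall A' y', A' `<=` A -> critical K A' y' ->
    below x y' -> agree y' x = agree y x -> ~ forall i, c y' i < c x i + d.
Proof.
move=> ycrit xy nyx.
have [i0 i0P] : exists i, c x i < c y i.
  apply: contrapT => none; apply: nyx => i; rewrite leNgt; apply/negP => xi.
  by apply: none; exists i.
have [|m m0 mP] := @finite_positive_lower_bound R I
    (fun i => i \notin agree y x) (fun i => c y i - c x i).
  by move=> i; rewrite agreeP subr_gt0 lt_neqAle eq_sym => ->; exact: xy.
(* [m] is the gap between x and y; two errors smaller than [m / 4] leave a
   descent from e to e' of more than [m / 2], while e allows [m / 4]. *)
exists (m / 4) => [|A' y' A'A y'crit xy' y'x y'm]; first lra.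
have [|e [[Ae emin] ye ye_near eK]] := ycrit (m / 4); first lra.
have [|m' m'0 m'P] := @finite_positive_lower_bound R I
    (fun i => i \notin K) (fun i => c e i - c y i).
  by move=> i; rewrite -eK agreeP subr_gt0 lt_neqAle eq_sym => ->; exact: ye.
have [|e' [[A'e' _] y'e' y'e'_near e'K]] := y'crit (Num.min (m / 4) m').
  by rewrite lt_min m'0 andbT; lra.
have e'_near i : c e' i < c y' i + m / 4 /\ c e' i < c y' i + m'.
  have := y'e'_near i; have : Num.min (m / 4) m' <= m / 4 by rewrite ge_min lexx.
  have : Num.min (m / 4) m' <= m' by rewrite ge_min lexx orbT.
  by split; lra.
have e'e : below e' e.
  move=> i; have [iyx|iyx] := boolP (i \in agree y x); last first.
    by have := mP i iyx; have := y'm i; have := ye i; case: (e'_near i); lra.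
  have := iyx; rewrite agreeP => /eqP yxi.
  move: (iyx); rewrite -y'x agreeP => /eqP y'xi.
  have [iK|iK] := boolP (i \in K).
    have := iK; rewrite -{1}e'K agreeP => /eqP ->.
    by have := iK; rewrite -eK agreeP => /eqP ->; lra.
  by have := m'P i iK; case: (e'_near i); lra.
have i0n : i0 \notin agree y x by rewrite agreeP gt_eqF.
have := emin _ (A'A _ A'e') e'e i0.
by have := mP _ i0n; have := y'm i0; have := ye i0; case: (e'_near i0); lra.
Qed.

(** The selections D t of the tasks t = (K, r) form antichains on K.  A limit of
  selections from infinitely many tasks is critical since the tolerance tends
  to 0 with the task number; this is where the absence of critical points makes
  the union closed discrete. *)
Lemma cover_noncritical F A M : closed F -> A `<=` F ->
  (forall a, A a -> forall i, M <= c a i) ->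
  (forall y, F y -> forall K, ~ critical K A y) ->
  exists D, [/\ D `<=` A, closed_discrete D &
    forall b, A b -> exists2 d, D d & below d b].
Proof.
move=> cF AF AM ncrit.
pose task := ({set I} * {ffun I -> rat})%type.
pose tol (j : nat) : R := j.+1%:R^-1.
have tol0 j : 0 < tol j by rewrite invr_gt0.
have tolS j k : (k <= j)%N -> tol j <= tol k.
  by move=> kj; rewrite lef_pV2 ?posrE ?ltr0Sn// ler_nat.
pose source (t : task) a := almost_minimal A (tol (pickle t)) a /\
  forall i, i \notin t.1 -> c a i <= ratr (t.2 i).
pose least (t : task) a := source t a /\ forall a', source t a' ->
  (forall i, i \in t.1 -> c a' i <= c a i) -> forall i, i \in t.1 -> c a' i = c a i.
pose val (t : task) a i := if i \in t.1 then c a i else 0.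
have /choice[D DP] t := exists_transversal [set a | least t a] (val t).
have Dcd t : closed_discrete (D t).
  have [Dleast _ Dinj] := DP t.
  apply: (@closed_discrete_antichain t.1) => d d' Dd Dd' dd'.
  apply: Dinj => //; apply: functional_extensionality_dep => i; rewrite /val.
  case: ifP => // it; have [_ d'P] := Dleast _ Dd'.
  by apply: d'P => //; have [] := Dleast _ Dd.
have DA t : D t `<=` A.
  by move=> d; have [Dleast _ _] := DP t; move=> /Dleast[[[]]].
exists (\bigcup_t D t); split=> [d [t _ /DA]//|x|b Ab].
  have [Fx|nFx] := pselect (F x); last first.
    near=> e => -[t _ /DA/AF Fe]; suff: ~ F e by [].
    by near: e; exact: near_notin_closed.
  have noncrit K : exists2 d, 0 < d & forall e, almost_minimal A d e -> below x e ->
      (forall i, c e i < c x i + d) -> agree e x <> K.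
    apply: contrapT => H; apply: (ncrit x Fx K) => d d0; apply: contrapT => H'.
    by apply: H; exists d => // e ? ? ? ?; apply: H'; exists e.
  have /choice[d dP] : forall K, exists d, 0 < d /\ forall e, almost_minimal A d e ->
      below x e -> (forall i, c e i < c x i + d) -> agree e x <> K.
    by move=> K; have [d] := noncrit K; exists d.
  have [|m m0 mP] := @finite_positive_lower_bound R {set I} xpredT d.
    by move=> K _; case: (dP K).
  have [k km] : exists k, tol k < m.
    exists (Num.bound m^-1).
    rewrite /tol invf_plt ?posrE//; apply: lt_trans (archi_boundP _) _.
      by rewrite invr_ge0 ltW.
    by rewrite ltr_nat.
  (* [k] bounds the numbers of the tasks that can select something near [x]. *)
  have early : \forall e \near x, forall j, (j < k)%N ->
      [set e | exists2 t, pickle t = j & D t e] e -> e = x.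
    apply: near_bounded_union => j.
    have [[t <-]|none] := pselect (exists t : task, pickle t = j).
      near=> e => -[t' /(pcan_inj pickleK) ->].
      by near: e; exact: Dcd.
    by apply: nearW => e [t tj]; case: none; exists t.
  near=> e => -[t _ Dte].
  have cone : forall i, c x i <= c e i < c x i + m by near: e; exact: near_cone.
  have [tk|kt] := ltnP (pickle t) k.
    have He : forall j, (j < k)%N ->
      [set e | exists2 t, pickle t = j & D t e] e -> e = x by near: e.
    by apply: (He _ tk); exists t.
  exfalso; have [_] := dP (agree e x); move=> /(_ e); apply => //.
  - have [Dleast _ _] := DP t; have [[+ _] _] := Dleast _ Dte.
    apply: almost_minimalW; apply: le_trans (mP _ isT); apply: le_trans (ltW km).
    exact: tolS.
  - by move=> i; case/andP: (cone i).
  - move=> i; case/andP: (cone i) => _ h; apply: lt_le_trans h _.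
    by rewrite lerD2l; exact: mP.
(* Coverage of b: K is a smallest set of coordinates shared with b by an element
   a of A below b.  An element of A below b that is under the bounds r off K
   cannot share fewer coordinates with b, so it shares exactly those of K. *)
pose P (K : {set I}) := `[< exists a, [/\ A a, below a b & agree a b = K] >].
have P0 : P (agree b b) by apply/asboolP; exists b; split.
case: (arg_minnP (fun K : {set I} => #|K|) P0) => K /asboolP[a [Aa ab abK]] Kmin.
have agree_big a' : A a' -> below a' b -> agree a' b \subset K -> agree a' b = K.
  move=> Aa' a'b sK; apply/eqP; rewrite eqEcard sK /=; apply: Kmin.
  by apply/asboolP; exists a'.
have /choice[r rP] : forall i, exists r : rat, i \notin K -> c a i < ratr r < c b i.
  move=> i; have [iK|iK] := boolP (i \in K); first by exists 0.
  have : c a i < c b i.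
    by move: iK; rewrite -abK agreeP lt_neqAle => ->; exact: ab.
  by move=> /rat_in_itvoo[q]; rewrite in_itv /= => qP; exists q.
pose t : task := (K, [ffun i => r i]).
have [|a' a'min a'a] := @almost_minimal_below A M (tol (pickle t)) a AM _ Aa => //.
have Aa' : A a' by case: a'min.
have srcK z : source t z -> (forall i, i \in K -> c z i <= c b i) ->
    below z b /\ agree z b = K.
  move=> [[Az _] zr] zK.
  have zb_lt i : i \notin K -> c z i < c b i.
    by move=> iK; have := zr _ iK; rewrite /= ffunE; case/andP: (rP i iK); lra.
  have zb : below z b.
    by move=> i; have [/zK//|/zb_lt/ltW] := boolP (i \in K).
  split=> //; apply: agree_big => //; apply/fintype.subsetP => i.
  by apply: contraLR => /zb_lt; rewrite agreeP => /lt_eqF ->.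
have srca' : source t a'.
  split=> // i iK; rewrite /= ffunE; apply: le_trans (a'a i) _.
  by case/andP: (rP i iK) => /ltW.
have a'b := below_trans a'a ab.
have [_ a'K] := srcK a' srca' (fun i _ => a'b i).
have leasta' : least t a'.
  split=> // z srcz zK i iK.
  have [|_ zbK] := srcK z srcz.
    by move=> j jK; apply: le_trans (a'b j); exact: zK.
  have := iK; rewrite /= -{1}zbK agreeP => /eqP ->.
  by move: iK; rewrite /= -{1}a'K agreeP => /eqP ->.
have [Dleast /(_ _ leasta')[d Dd dval] _] := DP t.
exists d; first by exists t.
have [|//] := srcK d (proj1 (Dleast _ Dd)).
move=> i iK; have := congr1 (fun f => f i) dval; rewrite /val /= iK => ->.
exact: a'b.
Unshelve. all: by end_near. Qed.

Variable N : X -> set X.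
Hypothesis NP : forall p, open_nbhs p (N p).

Definition fiber y := [set x | c x = c y].

Lemma closed_fiber y : closed (fiber y).
Proof.
move=> x xy; apply: functional_extensionality_dep => i; apply/eqP.
rewrite eq_le; apply/andP; split.
  have [e [<- /(_ i)/andP[]//]] := xy _ (near_cone x ltr01).
apply/ler_addgt0Pr => d d0.
by have [e [<- /(_ i)/andP[_ /ltW]]] := xy _ (near_cone x d0).
Qed.

(** The stages run along a well-order of the subsets of X.  Each stage covers the
  fiber of a critical point y of what is left, if there is one.  The points y
  of different stages are different, so some stage finds no critical point.
  The stages that come near x are sorted by the type of y and by the set of
  coordinates that y shares with x.  In each of these finitely many classes the
  first stage keeps the others away from x: if its y has the same coordinates
  as x, its star includes what was left of the fiber of x; if not, the reason is
  [critical_no_descent]. *)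
Lemma exhaust_critical F A : closed F ->
  (forall y G, closed G -> G `<=` F `&` fiber y -> coverable N G) ->
  exists D, [/\ D `<=` F, closed_discrete D &
    forall y, (F `\` star N D) y -> forall K, ~ critical K (A `&` (F `\` star N D)) y].
Proof.
move=> cF fib; have [lt [wf trans tot]] := exists_well_founded (set X).
pose ok G y K D := [/\ G y, critical K (A `&` G) y, D `<=` G `&` fiber y,
  closed_discrete D & G `&` fiber y `<=` star N D].
pose pick (_ : set X) G := xget set0 [set D | exists y K, ok G y K D].
have [D DE] := wf_stages N pick F wf.
pose G := residue N lt F D.
have GW v w : lt v w -> G w `<=` G v.
  by move=> vw; apply: residueW => u uv; exact: trans vw.
have G_avoid v w : lt v w -> G w `<=` ~` star N (D v).
  by move=> vw x [_ nx] Dx; apply: nx; exists v.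
have D_ok v d : D v d -> exists y K, ok (G v) y K (D v).
  by rewrite DE /pick; case: xgetP => [E _ [y [K Eok]] _|_ []//]; exists y, K.
have [w wP] : exists w, forall y, G w y -> forall K, ~ critical K (A `&` G w) y.
  apply: contrapT => H.
  have /choice[y yP] w : exists y, exists K, ok (G w) y K (D w).
    have [y [K [Gy yK]]] : exists y K, G w y /\ critical K (A `&` G w) y.
      apply: contrapT => H'; apply: H; exists w => y Gy K yK; apply: H'.
      by exists y, K.
    rewrite DE; have := @xgetPex _ set0 [set D | exists y K, ok (G w) y K D]; apply.
    have [||E [EG Ecd EP]] := fib y (G w `&` fiber y).
    - by apply: closedI; [exact: closed_residue | exact: closed_fiber].
    - by move=> x [[]].
    by exists E, y, K; split.
  apply: (@no_injection_from_powerset X y) => v w yvw.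
  apply: contrapT => vw.
  wlog {vw} vw : v w yvw / lt v w.
    by move=> H'; case: (tot _ _ vw) => h; [exact: H' h | exact: H' (esym yvw) h].
  have [K' [Gw _ _ _ _]] := yP w; have [K [Gv _ _ _ cov]] := yP v.
  apply: (G_avoid _ _ vw _ Gw); apply: cov; split; first exact: GW vw _ Gw.
  by rewrite /fiber /= yvw.
have starD : F `\` star N (\bigcup_(v in [set v | lt v w]) D v) = G w.
  congr setD; apply/seteqP; split=> x.
    by move=> [d [v vw Dd] dx]; exists v => //; exists d.
  by move=> [v vw [d Dd dx]]; exists d => //; exists v.
exists (\bigcup_(v in [set v | lt v w]) D v); rewrite starD; split=> //.
  by move=> d [v _ Dd]; have [y [K [_ _ DG _ _]]] := D_ok _ _ Dd; have [[]] := DG _ Dd.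
move=> x.
pose stages (t : {set I} * {set I}) := [set v | exists y,
  [/\ ok (G v) y t.1 (D v), below x y & agree y x = t.2]].
have stages_near t : \forall e \near x, forall v, stages t v -> D v e -> e = x.
  have [[v0 v0t]|none] := pselect (stages t !=set0); last first.
    by apply: nearW => e v vt; case: none; exists v.
  have {v0 v0t}[v0 v0t v0min] : exists2 v0, stages t v0 &
      forall v, stages t v -> v <> v0 -> lt v0 v.
    elim: (wf v0) v0t => {}v0 _ IH v0t.
    have [[u [ut uv0]]|nu] := pselect (exists u, stages t u /\ lt u v0).
      exact: IH ut.
    exists v0 => // v vt vv0; case: (tot _ _ vv0) => // vlt.
    by case: nu; exists v.
  have [y0 [[Gy0 y0crit _ Dcd y0cov] xy0 y0t]] := v0t.
  have [y0x|ny0x] := pselect (below y0 x).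
    near=> e => v vt Dve.
    have [vv0|vv0] := pselect (v = v0).
      by move: Dve; rewrite vv0; near: e; exact: Dcd.
    have v0v := v0min _ vt vv0; have [y [[Gy _ _ _ _] xy yt]] := vt.
    case: (G_avoid _ _ v0v _ Gy); apply: y0cov; split; first exact: GW v0v _ Gy.
    apply: functional_extensionality_dep => i.
    have y0i : c y0 i = c x i by apply/eqP; rewrite eq_le y0x xy0.
    by apply/eqP; rewrite y0i -agreeP yt -y0t agreeP y0i.
  have [d d0 dP] := critical_no_descent y0crit xy0 ny0x.
  near=> e => v vt Dve.
  have [vv0|vv0] := pselect (v = v0).
    by move: Dve; rewrite vv0; near: e; exact: Dcd.
  have v0v := v0min _ vt vv0; have [y [[Gy ycrit DG _ _] xy yt]] := vt.
  case: (dP _ y _ ycrit xy); first by apply: setIS; exact: GW.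
    by rewrite yt.
  move=> i; have [_ <-] := DG _ Dve.
  have /(_ i) : forall i, c x i <= c e i < c x i + d by near: e; exact: near_cone.
  by case/andP.
have all_stages : \forall e \near x, forall t v, stages t v -> D v e -> e = x.
  exact: filter_forall.
near=> e => -[v _ Dve].
have He : forall t v, stages t v -> D v e -> e = x by near: e.
have [y [K vok]] := D_ok _ _ Dve; apply: (He (K, agree y x) v) => //.
exists y; split=> // i; have [_ _ DG _ _] := vok; have [_ <-] := DG _ Dve.
have /(_ i) : forall i, c x i <= c e i < c x i + 1 by near: e; exact: near_cone.
by case/andP.
Unshelve. all: by end_near. Qed.

(** By the last hypothesis, an element of the piece A that lies above a selected
  one is covered by it, so the two previous lemmas combine. *)
Lemma cover_upward_piece F A M : closed F ->
  (forall y G, closed G -> G `<=` F `&` fiber y -> coverable N G) ->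
  (forall a, A a -> forall i, M <= c a i) ->
  (forall a b, A a -> A b -> below a b -> N a b) ->
  exists D, [/\ D `<=` F, closed_discrete D & A `&` F `<=` star N D].
Proof.
move=> cF fib AM AN; have [D [DF Dcd Dcrit]] := exhaust_critical A cF fib.
have cG : closed (F `\` star N D).
  by rewrite setDE; apply: closedI => //; apply: open_closedC; exact: open_star.
have [|a [Aa _]|E [EA Ecd EP]] := cover_noncritical (M := M) cG _ _ Dcrit.
- by move=> x [].
- exact: AM.
exists (D `|` E); split.
- by move=> x [/DF//|/EA[_ []]].
- exact: closed_discreteU.
- move=> x [Ax Fx]; rewrite starU; have [Dx|nDx] := pselect (star N D x); first by left.
  right; have [|e Ee ex] := EP x; first by split.
  by exists e => //; have [Ae _] := EA _ Ee; exact: AN.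
Qed.

End Cones.

(** * Neighbourhoods in the countable Sorgenfrey power *)

Section SorgenfreyPower.
Variable R : realType.
Local Notation S := (sorgenfrey R).
Local Notation X := (prod_topology (fun _ : nat => S)).

Lemma near_sorgenfrey (a : S) (e : R) : 0 < e ->
  \forall y \near a, (a : R) <= (y : R) < (a : R) + e.
Proof.
move=> e0; apply: (@open_nbhs_nbhs _ _ (sorgenfrey_base ((a : R), (a : R) + e))).
split; last by rewrite /sorgenfrey_base /= lexx ltrDl.
exists [set ((a : R), (a : R) + e)]; last by rewrite bigcup_set1.
move=> _ ->; change ((a : R) < (a : R) + e); by rewrite ltrDl.
Qed.

Lemma nbhs_sorgenfrey (a : S) (B : set S) : nbhs a B ->
  exists2 e : R, 0 < e & forall y : S, (a : R) <= (y : R) < (a : R) + e -> B y.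
Proof.
rewrite nbhsE => -[C [[J _ <-] [[u v] Juv /andP[ua av]]] CB].
exists ((v : R) - a); first by rewrite subr_gt0.
move=> y /andP[ay ya]; apply: CB; exists (u, v) => //.
change ((u : R) <= (y : R) < (v : R)); apply/andP; split; first exact: le_trans ua ay.
by move: ya; rewrite subrKC.
Qed.

(** Names the coordinates as elements of R, where they can be compared. *)
Definition coord (p : X) (i : nat) : R := p i.

Definition box n (p : X) : set X :=
  [set q | forall i, (i < n)%N -> coord p i <= coord q i < coord p i + n.+1%:R^-1].

Lemma box_le m n p : (m <= n)%N -> box n p `<=` box m p.
Proof.
move=> mn q pq i im; have /andP[-> /= h] := pq i (leq_trans im mn).
apply: lt_le_trans h _; rewrite lerD2l lef_pV2 ?posrE ?ltr0Sn//.
by rewrite ler_nat.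
Qed.

Lemma near_cone_prefix n (x : X) e : 0 < e ->
  \forall y \near x, forall i : 'I_n, coord x i <= coord y i < coord x i + e.
Proof.
move=> e0.
pose near_i (i : 'I_n) := [set y : X | coord x i <= coord y i < coord x i + e].
apply: (@filter_forall _ _ near_i (nbhs x) (nbhs_filter x)) => i.
exact: (@proj_continuous nat (fun=> S) i x _ (near_sorgenfrey (x i) e0)).
Qed.

(** The boxes at x generate a filter whose projections converge to the
  coordinates of x, so it converges to x in the product topology. *)
Lemma nbhs_box (x : X) B : nbhs x B -> exists n, box n x `<=` B.
Proof.
pose V : set_system X := filter_from setT (fun n => box n x).
have FV : Filter V.
  apply: filter_from_filter; first by exists 0%N.
  move=> m n _ _; exists (maxn m n) => // y xy.
  by split; apply: box_le xy; rewrite ?leq_maxl ?leq_maxr.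
suff /(_ B) VB : V --> x by move=> /VB[n _]; exists n.
apply/cvg_sup => i; apply/cvg_image.
  apply/seteqP; split=> // y _; exists (dfwith x i y) => //.
move=> C /nbhs_sorgenfrey[e e0 eC].
exists [set p : X | C (p i)]; last first.
  apply/seteqP; split=> [_ [p Cp <-]//|y Cy]; exists (dfwith x i y).
    by rewrite /= dfwithin.
  exact: dfwithin.
have [k ke] : exists k : nat, k.+1%:R^-1 < e.
  exists (Num.bound e^-1); rewrite invf_plt ?posrE ?ltr0Sn//.
  apply: lt_trans (archi_boundP _) _; first by rewrite invr_ge0 ltW.
  by rewrite ltr_nat.
exists (maxn i.+1 k) => // p xp; apply: eC.
have /andP[h1 h2] := box_le (leq_maxl i.+1 k) xp (ltnSn i).
rewrite [_ <= _]h1 /=.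
apply: lt_le_trans (proj2 (andP (xp i (leq_maxl i.+1 k)))) _.
rewrite lerD2l; apply: le_trans (ltW ke).
by rewrite lef_pV2 ?posrE ?ltr0Sn// ler_nat ltnS leq_maxr.
Qed.

Lemma near_ne_power (x y : X) : \forall e \near x, e = y -> e = x.
Proof.
have [->|/eqP yx] := eqVneq y x.
  exact: (nearW (nbhs_filter x)).
have [i yxi] : exists i, coord y i <> coord x i.
  apply: contrapT => H; apply: yx; apply: functional_extensionality_dep => i.
  by apply: contrapT => h; apply: H; exists i.
suff : \forall e \near x, coord e i <> coord y i.
  by apply: filterS => e ey eE; rewrite eE in ey.
have [xy|yx'|yx'] := ltgtP (coord x i) (coord y i); last by case: yxi.
- have := @near_cone_prefix i.+1 x (coord y i - coord x i); rewrite subr_gt0 => /(_ xy).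
  by apply: filterS => e /(_ ord_max)/andP[_] /= h ey; move: h; rewrite ey; lra.
- have := @near_cone_prefix i.+1 x 1 ltr01.
  by apply: filterS => e /(_ ord_max)/andP[] /= h _ ey; move: h; rewrite ey; lra.
Qed.

(** * Reduction to slices and conclusion *)

Section Assignment.
Variable N : X -> set X.
Hypothesis NP : forall p, open_nbhs p (N p).

Definition agree_upto n (G : set X) :=
  forall p q, G p -> G q -> forall i, (i < n)%N -> coord p i = coord q i.

(** The pieces are indexed by n and by a cell of side 1/(n+1) in the first n
  coordinates.  Two points of a cell differ by less than this side, so a point
  q of a piece that is above a point p of the same piece is in the box of p.
  Taking n >= m makes the fibers over R^n contained in slices. *)
Lemma coverable_of_slices m (F : set X) : closed F ->
  (forall G, closed G -> G `<=` F -> agree_upto m G -> coverable N G) ->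
  coverable N F.
Proof.
move=> cF slices.
pose piece (ns : nat * seq int) p := [/\ (m <= ns.1)%N, box ns.1 p `<=` N p &
  forall i : 'I_ns.1, Num.floor (coord p i * ns.1.+1%:R) = nth 0 ns.2 i].
pose A k p := exists2 ns, unpickle k = Some ns & piece ns p.
apply: (coverable_countable NP cF (A := A)) => [x Fx|k G cG GF].
  have [n nx] : exists n, box n x `<=` N x.
    by apply: nbhs_box; exact: open_nbhs_nbhs.
  pose l := maxn m n.
  exists (pickle (l, mkseq (fun i => Num.floor (coord x i * l.+1%:R)) l)).
  eexists; first exact: pickleK.
  split=> [||i] /=; first exact: leq_maxl.
    by apply: subset_trans nx; apply: box_le; exact: leq_maxr.
  by rewrite nth_mkseq.
have [[[n s] ns]|none] :=
    pselect (exists ns : nat * seq int, unpickle k = Some ns); last first.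
  exists set0; split=> //; first exact: closed_discrete0.
  by move=> x [[ns nsk]]; case: none; exists ns.
have [mn|nm] := leqP m n; last first.
  exists set0; split=> //; first exact: closed_discrete0.
  move=> x [[ns']]; rewrite ns => -[<-] [/=]; rewrite leqNgt.
  by move: nm => /= ->.
have pieceP p : A k p -> piece (n, s) p by move=> [ns']; rewrite ns => -[<-].
have floorP p : A k p -> forall i : 'I_n,
    (nth 0 s i)%:~R / n.+1%:R <= coord p i < (nth 0 s i)%:~R / n.+1%:R + n.+1%:R^-1.
  move=> /pieceP[_ _ /= ps] i; rewrite -ps.
  rewrite ler_pdivrMr ?ltr0Sn// floor_le/= -[X in _ < _ + X]mul1r -mulrDl.
  by rewrite ltr_pdivlMr ?ltr0Sn// -intrD1; exact: floorD1_gt.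
have [M MP] : exists M, forall p, A k p -> forall i : 'I_n, M <= coord p i.
  exists (\big[Num.min/0]_(i < n) ((nth 0 s i)%:~R / n.+1%:R)) => p Ap i.
  have /andP[+ _] := floorP p Ap i; apply: le_trans.
  by rewrite (bigD1 i) //= ge_min lexx.
apply: (cover_upward_piece (c := fun (p : X) (i : 'I_n) => coord p i)
  (@near_cone_prefix n) near_ne_power NP cG _ MP).
- move=> y E cE EG; apply: slices => //; first by move=> x /EG[/GF].
  move=> p q Ep Eq i im.
  have [_ py] := EG _ Ep; have [_ qy] := EG _ Eq.
  have := congr1 (fun f => f (Ordinal (leq_trans im mn))) (etrans py (esym qy)).
  by [].
- move=> p q Ap Aq pq; have [_ + _] := pieceP p Ap; apply=> i im.
  have := pq (Ordinal im); rewrite /= => -> /=.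
  have /andP[zp _] := floorP p Ap (Ordinal im).
  have /andP[_ qz] := floorP q Aq (Ordinal im).
  by apply: lt_le_trans qz _; rewrite lerD2r.
Qed.

(** Non-coverable closed sets F n, decreasing, whose points agree on the first n
  coordinates: they shrink to a point y, and N y includes one of them. *)
Lemma coverable_setT : coverable N setT.
Proof.
apply: contrapT => bad0.
pose bad F := closed F /\ ~ coverable N F.
have next m F : bad F -> exists G, [/\ bad G, G `<=` F & agree_upto m G].
  move=> [cF nF]; apply: contrapT => H; apply: nF.
  apply: (@coverable_of_slices m) => // G cG GF Gm; apply: contrapT => nG.
  by apply: H; exists G.
have /choice[f fP] : forall mF : nat * set X, exists G, bad mF.2 ->
    [/\ bad G, G `<=` mF.2 & agree_upto mF.1 G].
  move=> [m F]; have [bF|nbF] := pselect (bad F); last by exists set0.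
  by have [G GP] := next m F bF; exists G.
pose F := fix F n := if n is k.+1 then f (k.+1, F k) else setT.
have badF n : bad (F n).
  elim: n => [|n IH]; first by split=> //; exact: closedT.
  by have [] := fP (n.+1, F n) IH.
have FS n : F n.+1 `<=` F n by have [] := fP (n.+1, F n) (badF n).
have Fagree n : agree_upto n (F n).
  by case: n => [|n] //; have [] := fP (n.+1, F n) (badF n).
have Fle m n : (m <= n)%N -> F n `<=` F m.
  elim: n => [|n IH]; first by rewrite leqn0 => /eqP->.
  by rewrite leq_eqVlt => /orP[/eqP->//|/IH]; apply: subset_trans; exact: FS.
have /choice[x xP] n : exists x, F n x.
  apply: contrapT => H; have [_] := badF n; apply; exists set0; split=> //.
    exact: closed_discrete0.
  by move=> x Fx; case: H; exists x.
(* x i.+1 rather than x i: the coordinate of index i is fixed from stage i.+1. *)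
pose y : X := fun i => x i.+1 i.
have xy n i : (i < n)%N -> coord (x n) i = coord y i.
  move=> i_n; apply: (Fagree i.+1 (x n) (x i.+1)) => //.
  exact: Fle i_n _ (xP n).
have Fy n : F n y.
  have [cF _] := badF n; apply: cF => B /nbhs_box[l lB].
  exists (x (maxn l n)); split; first exact: Fle (leq_maxr l n) _ (xP _).
  apply: lB => i il; rewrite xy ?lexx ?ltrDl ?invr_gt0 ?ltr0Sn//.
  exact: leq_trans il (leq_maxl l n).
have [n ny] : exists n, box n y `<=` N y.
  by apply: nbhs_box; exact: open_nbhs_nbhs.
have [_] := badF n; apply; exists [set y]; split.
- by move=> _ ->.
- by move=> z; exact: near_ne_power.
- move=> z Fz; exists y => //; apply: ny => i i_n.
  by rewrite (Fagree n _ _ Fz (Fy n)) ?lexx ?ltrDl ?invr_gt0 ?ltr0Sn.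
Qed.

End Assignment.
End SorgenfreyPower.

Theorem theorem10 (R : realType) :
  D_space (prod_topology (fun _ : nat => sorgenfrey R)).
Proof.
move=> phi phiP; have [D [_ Dcd Dcov]] := coverable_setT phiP.
exists D; split; [exact: closed_discrete_closed|exact: closed_discrete_discrete|].
by apply/seteqP; split=> // x _; exact: Dcov.
Qed.
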